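(* Let $m\in\mathbb N+1$, $n\in\mathbb N^m\setminus\{1_m\}$, and let $M\in\mathbb N_0^n$ be a principal reversible cuboid. If $M_{[\tilde n]}$, with $\tilde n\le n$, $\tilde n\ne n$, is a maximal proper principal reversible subcuboid of $M$, then there is $j\in\{1,\dots,m\}$ such that $\tilde n_i=n_i$ for all $i\ne j$.
   Context: $\mathbb N=\{1,2,\dots\}$, $\mathbb N_0=\mathbb N\cup\{0\}$, $\mathbb N+1=\{2,3,\dots\}$, $\langle N\rangle=\{0,\dots,N-1\}$. For $n\in\mathbb N^m$, a cuboid $M\in\mathbb N_0^n$ has entries $M_k\in\mathbb N_0$ for $k\in\mathbb N^m$, $k\le n$ componentwise; $1_m=(1,\dots,1)$, $e_j$ the $j$-th unit vector. Property (V): for all $1\le i<j\le m$ and all index vectors in range, $M_{k_1,\dots,k_i,\dots,k_j,\dots,k_m}+M_{k_1,\dots,k_i',\dots,k_j',\dots,k_m}=M_{k_1,\dots,k_i,\dots,k_j',\dots,k_m}+M_{k_1,\dots,k_i',\dots,k_j,\dots,k_m}$. $M$ is a principal reversible cuboid if it has (V), its set of entries is $\langle\prod_jn_j\rangle$, and $M_k<M_{k+le_j}$ whenever $1\le l\le n_j-k_j$ (dimensions equal to 1 allowed). For $\tilde n\le n$, $M_{[\tilde n]}=(M_k)_{k\le\tilde n}$; it is a principal reversible subcuboid if it is itself a principal reversible cuboid (of dimension $\tilde n$), and proper if $\tilde n\ne n$. A proper principal reversible subcuboid is maximal if it is not properly contained in another proper principal reversible subcuboid $M_{[n']}$ of $M$.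 *)

(* Defs.v *)
From mathcomp Require Import all_boot.

Set Implicit Arguments.
Unset Strict Implicit.
Unset Printing Implicit Defensive.

(* Integer vectors of length m.  Coordinates are numbered from 0 ('I_m), but
   the index vectors of a cuboid have entries starting at 1. *)
Definition vec (m : nat) := {ffun 'I_m -> nat}.

Definition ones (m : nat) : vec m := [ffun=> 1].

Definition posvec (m : nat) (n : vec m) : Prop := forall i, 0 < n i.

Definition vle (m : nat) (a b : vec m) : Prop := forall i, a i <= b i.

Definition in_range (m : nat) (n k : vec m) : Prop := posvec k /\ vle k n.

Definition upd (m : nat) (k : vec m) (i : 'I_m) (a : nat) : vec m :=
  [ffun x => if x == i then a else k x].

(* The vector k + l e_j. *)
Definition shift (m : nat) (k : vec m) (l : nat) (j : 'I_m) : vec m :=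
  [ffun x => k x + l * (x == j)].

(* A cuboid of dimension n is a total function of which only the values at the
   k with in_range n k matter: every predicate below that takes a dimension n
   evaluates M in that range only.  The subcuboid M_[n'], n' <= n, is thus the
   same function taken with dimension n'. *)
Definition cuboid (m : nat) := vec m -> nat.

Definition property_V (m : nat) (n : vec m) (M : cuboid m) : Prop :=
  forall (i j : 'I_m) (k : vec m) (ki' kj' : nat),
    i < j -> in_range n k -> 1 <= ki' <= n i -> 1 <= kj' <= n j ->
    M k + M (upd (upd k i ki') j kj') = M (upd k j kj') + M (upd k i ki').

(* posvec n is part of the definition: a dimension vector with a zero entry
   would satisfy the other three clauses vacuously. *)
Definition principal_reversible (m : nat) (n : vec m) (M : cuboid m) : Prop :=
  [/\ posvec n,
      property_V n M,
      forall v : nat,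
        (exists2 k, in_range n k & M k = v) <-> v < \prod_(j < m) n j
    & forall (k : vec m) (j : 'I_m) (l : nat),
        in_range n k -> 1 <= l <= n j - k j -> M k < M (shift k l j)].

Definition proper_pr_subcuboid (m : nat) (n : vec m) (M : cuboid m)
    (n' : vec m) : Prop :=
  [/\ vle n' n, n' <> n & principal_reversible n' M].

Definition maximal_proper_pr_subcuboid (m : nat) (n : vec m) (M : cuboid m)
    (n' : vec m) : Prop :=
  proper_pr_subcuboid n M n' /\
  ~ exists n'' : vec m,
      [/\ proper_pr_subcuboid n M n'', vle n' n'' & n' <> n''].

(* Main.v *)
Require Import Defs.
From mathcomp Require Import all_boot.
From mathcomp Require Import zify.

Set Implicit Arguments.
Unset Strict Implicit.
Unset Printing Implicit Defensive.

(** By (V) the cuboid is M_k = sum_i f_i(k_i), so the axis sets A_i = range f_i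
    form a direct sum decomposition of {0, ..., N-1}.  De Bruijn's argument: if
    1 lies in A_j and r is the least number outside A_j, then A_j is a union of
    blocks [tr, tr+r) and every other A_i consists of multiples of r; dividing
    by r and inducting yields a topmost block, i.e. an index j and some p < N
    such that A_i lies below p for i <> j and the parts of all A_i below p
    decompose {0, ..., p-1}.  These parts form a proper principal reversible
    subcuboid n' that agrees with n off j.  A principal reversible subcuboid
    of size at most p is contained in n', and one of size greater than p
    contains n'; so in both cases a maximal one agrees with n off j. *)

(** * Block structure of a direct sum of two sets *)

Definition direct_pair (A B : nat -> Prop) (N : nat) : Prop :=
  (forall a b a' b', A a -> B b -> A a' -> B b' -> a + b = a' + b' ->
     a = a' /\ b = b') /\
  (forall x, (exists a b, [/\ A a, B b & a + b = x]) <-> x < N).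

(** Strong induction on the block number [t]: below [t * r] the set [A] is a union of whole blocks
    and [B] consists of multiples of [r]. The unique representation of [t * r] itself then decides
    the next block. *)
Lemma direct_pair_blocks (A B : nat -> Prop) (N r : nat) :
  direct_pair A B N -> 0 < r -> (forall x, x < r -> A x) -> B 0 -> B r ->
  forall t s, s < r ->
    (A (t * r + s) <-> A (t * r)) /\ (B (t * r + s) -> s = 0).
Proof.
move=> [uniqAB covAB] r0 Ar B0 Br.
have A0 : A 0 by exact: Ar.
have Bsmall b : B b -> b < r -> b = 0.
  by move=> Bb br; have [] := uniqAB _ _ _ _ (Ar _ br) B0 A0 Bb (addnC _ _).
have Abnd a : A a -> a < N.
  by move=> Aa; apply/covAB; exists a, 0; rewrite addn0.
have Bbnd b : B b -> b < N by move=> Bb; apply/covAB; exists 0, b.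
elim/ltn_ind => -[|t] IH s sr.
  rewrite mul0n add0n; split; first by split=> _; [exact: A0 | exact: Ar].
  by move=> /Bsmall; exact.
set T := t.+1 * r in IH *.
have rT : r <= T by rewrite /T mulSn leq_addr.
have decomp y : y < T -> exists t' s', [/\ t' < t.+1, s' < r & y = t' * r + s'].
  move=> yT; exists (y %/ r), (y %% r); split; last exact: divn_eq.
    by rewrite ltn_divLR.
  exact: ltn_pmod.
have [TN|NT] := ltnP T N; last first.
  split; first by split=> /Abnd; lia.
  by move/Bbnd; lia.
(* Case split on the representation T = a + b: T in B, T in A, or neither. *)
have [a [b [Aa Bb abT]]] := (covAB T).2 TN.
have [a0|a_gt0] := posnP a.
  have BT : B T by rewrite -abT a0.
  split.
    split=> AT.
      have [] := uniqAB _ _ _ _ AT B0 (Ar _ sr) BT; lia.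
    have [] := uniqAB _ _ _ _ AT B0 A0 BT; lia.
  move=> BTs.
  have [] := uniqAB _ _ _ _ (Ar _ sr) BT A0 BTs; lia.
have [b0|b_gt0] := posnP b.
  have AT : A T by rewrite -abT b0 addn0.
  (* Since [T] is in [A] and [r] in [B], the whole block starting at [T] lies below [N], so each
     [T + s] has a representation. *)
  have ATr : T + r <= N by apply/ltnW/covAB; exists T, r.
  have Bno u : 0 < u -> u < r -> ~ B (T + u).
    move=> u0 ur BTu.
    (* Otherwise T + r = (r - u) + (T + u) has two representations. *)
    have ru : r - u < r by lia.
    have [] := uniqAB _ _ _ _ (Ar _ ru) BTu AT Br; lia.
  split; last first.
    by case: (posnP s) => // s0 /(Bno _ s0 sr).
  split=> // _.
  have [a' [b' [Aa' Bb' abs]]] := (covAB (T + s)).2 ltac:(lia).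
  have [Ta'|a'T] := leqP T a'.
    have b'0 : b' = 0 by apply: Bsmall => //; lia.
    by move: Aa'; rewrite -abs b'0 addn0.
  have [Tb'|b'T] := leqP T b'.
    have [b'e|b'e] := eqVneq b' T.
      have [] := uniqAB _ _ _ _ AT B0 A0 Bb'; lia.
    case: (Bno (b' - T)); rewrite ?subnKC //; lia.
  (* Both summands are below [T]. The one in [B] is a multiple of [r], so the residue [s] comes from
     [a']; rounding [a'] down gives a second representation of [T]. *)
  have [ta [sa [tal sal ea]]] := decomp _ a'T.
  have [tb [sb [tbl sbl eb]]] := decomp _ b'T.
  have sb0 : sb = 0 by apply: (IH tb tbl sb sbl).2; rewrite -eb.
  have Ata : A (ta * r) by apply/(IH ta tal sa sal).1; rewrite -ea.
  have es : sa = s.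
    have := congr1 (modn^~ r) abs.
    by rewrite ea eb sb0 addn0 addnAC -mulnDl /T !modnMDl !modn_small.
  have [] := uniqAB _ _ _ _ Ata Bb' AT B0; lia.
(* Both summands are positive and [a] starts a whole block of [A], so [T + u = (a + u) + b] for all
   [u < r]. By uniqueness [T + u] is in neither [A] nor [B]. *)
have aT : a < T by lia.
have bT : b < T by lia.
have [ta [sa [tal sal ea]]] := decomp _ aT.
have [tb [sb [tbl sbl eb]]] := decomp _ bT.
have sb0 : sb = 0 by apply: (IH tb tbl sb sbl).2; rewrite -eb.
have es : sa = 0.
  have := congr1 (modn^~ r) abT.
  by rewrite ea eb sb0 addn0 addnAC -mulnDl /T modnMDl modnMl modn_small.
have As u : u < r -> A (a + u).
  move=> ur; rewrite ea es addn0; apply/(IH ta tal u ur).1.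
  by rewrite -[ta * r]addn0 -es -ea.
have Ano u : u < r -> ~ A (T + u).
  by move=> ur ATu; have [] := uniqAB _ _ _ _ (As u ur) Bb ATu B0; lia.
split.
  split=> AT; first by case: (Ano s).
  by case: (Ano 0 r0); rewrite addn0.
by move=> BTs; have [] := uniqAB _ _ _ _ (As s sr) Bb A0 BTs; lia.
Qed.

(** * Direct sums of finitely many sets *)

Definition direct_sum (m : nat) (A : 'I_m -> pred nat) (N : nat) : Prop :=
  (forall a b : vec m, (forall i, A i (a i)) -> (forall i, A i (b i)) ->
     \sum_i a i = \sum_i b i -> a = b) /\
  (forall x, (exists2 a : vec m, forall i, A i (a i) & \sum_i a i = x)
     <-> x < N).

Lemma sum_upd (m : nat) (F : 'I_m -> nat -> nat) (k : vec m) j x :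
  \sum_i F i (upd k j x i) = F j x + \sum_(i | i != j) F i (k i).
Proof.
rewrite (bigD1 j) //= ffunE eqxx; congr (_ + _).
by apply: eq_bigr => i /negPf ij; rewrite ffunE ij.
Qed.

Lemma sum_updD (m : nat) (F : 'I_m -> nat -> nat) (k : vec m) j x :
  \sum_i F i (upd k j x i) + F j (k j) = \sum_i F i (k i) + F j x.
Proof. by rewrite sum_upd [in RHS](bigD1 j) //=; lia. Qed.

Section DirectSum.

Variables (m : nat) (A : 'I_m -> pred nat) (N : nat).
Hypothesis dsA : direct_sum A N.
Hypothesis N_gt0 : 0 < N.

Let zero : vec m := [ffun=> 0].

Lemma direct_sum0 i : A i 0.
Proof.
have [a Aa /eqP] := (dsA.2 0).2 N_gt0.
by rewrite sum_nat_eq0 => /forallP/(_ i)/eqP <-.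
Qed.

Lemma upd_mem (a : vec m) j x :
  (forall i, A i (a i)) -> A j x -> forall i, A i (upd a j x i).
Proof. by move=> Aa Ax i; rewrite ffunE; case: eqP => [->|]. Qed.

Lemma sum_upd0 j x : \sum_i upd zero j x i = x.
Proof.
rewrite (sum_upd (fun=> id)) big1 ?addn0 // => i _; exact: ffunE.
Qed.

Lemma zero_mem i : A i (zero i).
Proof. by rewrite ffunE; exact: direct_sum0. Qed.

Lemma direct_sum_lt i x : A i x -> x < N.
Proof.
move=> Ax; apply/dsA.2; exists (upd zero i x); last exact: sum_upd0.
exact: upd_mem zero_mem Ax.
Qed.

Lemma direct_sum_disjoint i j x : i != j -> A i x -> A j x -> x = 0.
Proof.
move=> ij Ai Aj.
have := dsA.1 (upd zero i x) (upd zero j x) (upd_mem zero_mem Ai)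
  (upd_mem zero_mem Aj).
by rewrite !sum_upd0 => /(_ erefl) /ffunP /(_ i); rewrite !ffunE eqxx (negPf ij).
Qed.

(** Grouping all summands other than [A j] into one set makes the block lemma for two summands
    applicable. *)
Lemma direct_sum_pair j :
  direct_pair (A j)
    (fun x => exists2 a : vec m, forall i, A i (a i) & \sum_(i | i != j) a i = x)
    N.
Proof.
split=> [x _ x' _ Ax [a Aa <-] Ax' [b Ab <-]|x].
  rewrite -!(sum_upd (fun=> id)) => /(dsA.1 _ _ (upd_mem Aa Ax) (upd_mem Ab Ax')).
  move=> /ffunP e; split; first by have := e j; rewrite !ffunE eqxx.
  by apply: eq_bigr => i ij; have := e i; rewrite !ffunE (negPf ij).
split=> [[y [_ [Ay [a Aa <-] <-]]]|/dsA.2 [a Aa <-]].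
  rewrite -(sum_upd (fun=> id)); apply/dsA.2.
  by exists (upd a j y) => //; exact: upd_mem.
exists (a j), (\sum_(i | i != j) a i); split=> //; first by exists a.
by rewrite [RHS](bigD1 j).
Qed.

End DirectSum.

(** Induction on [N], dividing all sets by the length [r] of the initial run of [A j], where [A j]
    contains 1. The top index found for the quotient is kept and its [p] is multiplied by [r]. *)
Lemma direct_sum_top (m : nat) (N : nat) (A : 'I_m -> pred nat) :
  direct_sum A N -> 1 < N ->
  exists j p, [/\ 0 < p < N,
    forall i x, i != j -> A i x -> x < p &
    forall a : vec m, (forall i, A i (a i) /\ a i < p) -> \sum_i a i < p].
Proof.
elim/ltn_ind: N A => N IH A dsA N1.
have N0 : 0 < N by lia.
have A0 := direct_sum0 dsA N0.
have [a1 Aa1 sum1] := (dsA.2 1).2 N1.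
have [j a1j] : exists j, 0 < a1 j.
  apply/existsP; apply: contraTT isT; rewrite negb_exists => /forallP h.
  by move: sum1; rewrite big1 // => i _; have := h i; lia.
have Aj1 : A j 1.
  have -> : 1 = a1 j by move: sum1; rewrite (bigD1 j) //=; lia.
  exact: Aa1.
have exr : exists r, ~~ A j r.
  by exists N; apply/negP => /(direct_sum_lt dsA N0); lia.
case: (ex_minnP exr) => r Ajr minr.
have Ar x : x < r -> A j x.
  by move=> xr; apply: contraTT isT => /minr; lia.
have r1 : 1 < r.
  by case: r Ajr {minr Ar} => [|[|r]] //; rewrite ?A0 ?Aj1.
have r0 : 0 < r := ltnW r1.
(* If [A j] fills everything below [N], every other set is reduced to 0 and [p = 1] works. *)
have [rN|Nr] := ltnP r N; last first.
  exists j, 1; split=> // [i x ij Ax|a Aa].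
    rewrite ltnS leqn0; apply/eqP/(direct_sum_disjoint dsA N0 ij Ax)/Ar.
    exact: leq_trans (direct_sum_lt dsA N0 Ax) Nr.
  by rewrite big1 // => i _; have [] := Aa i; lia.
set B := fun x => exists2 a : vec m, forall i, A i (a i) &
                    \sum_(i | i != j) a i = x.
have dp : direct_pair (A j) B N := direct_sum_pair dsA j.
have zA i : A i ([ffun=> 0] i : nat) by rewrite ffunE.
have B0 : B 0.
  by exists [ffun=> 0] => //; rewrite big1 // => i _; rewrite ffunE.
(* In [r = y + z], a [z] below [r] would lie in both [A j] and [B], hence be 0, and [r] would be in
   [A j]. *)
have Br : B r.
  have [y [z [Ay Bz yz]]] := (dp.2 r).2 rN.
  have [zr|rz] := ltnP z r; last by have <- : z = r by lia.
  have [] := dp.1 _ _ _ _ (Ar z zr) B0 (A0 j) Bz (addnC _ _).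
  by move=> z0; move: Ajr; rewrite -yz z0 addn0 Ay.
have blk := direct_pair_blocks dp r0 Ar B0 Br.
have blkj x : A j x <-> A j (x %/ r * r).
  by have [] := blk (x %/ r) _ (ltn_pmod x r0); rewrite -divn_eq.
have AB i x : i != j -> A i x -> B x.
  move=> ij Ax; exists (upd [ffun=> 0] i x); first exact: upd_mem.
  rewrite -[RHS](sum_upd0 i) [RHS](bigD1 j) //= [X in _ = X + _]ffunE eq_sym (negPf ij).
  by rewrite ffunE.
have blki i x : i != j -> A i x -> x = x %/ r * r.
  move=> ij Ax; have := AB _ _ ij Ax; rewrite {1}(divn_eq x r).
  move=> /(blk _ _ (ltn_pmod _ r0)).2 e.
  by rewrite {1}(divn_eq x r) e addn0.
have Adiv i x : A i x -> A i (x %/ r * r).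
  by have [->|ij] := eqVneq i j; [move/blkj | move=> Ax; rewrite -(blki _ _ ij Ax)].
have rN2 : r.*2 <= N.
  have : (r.-1 + r) < N by apply/dp.2; exists r.-1, r; split=> //; apply: Ar; lia.
  lia.
set A' := fun i => [pred t | A i (t * r)].
have dsA' : direct_sum A' (N %/ r).
  split=> [a b Aa Ab eab|x].
    have : [ffun i => a i * r] = [ffun i => b i * r] :> vec m.
      apply: dsA.1 => [i|i|]; rewrite ?ffunE; [exact: Aa|exact: Ab|].
      under eq_bigr do rewrite ffunE.
      under [RHS]eq_bigr do rewrite ffunE.
      by rewrite -!big_distrl /= eab.
    move/ffunP => e; apply/ffunP => i; have := e i; rewrite !ffunE.
    by move/eqP; rewrite eqn_pmul2r // => /eqP.
  rewrite leq_divRL //; split=> [[a Aa <-]|xN].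
    (* The bound [N %/ r] requires the whole block above the sum to fit below [N]; its last element
       is reached by adding [r.-1] to the [j]-th summand, which stays in [A j]. *)
    have -> : (\sum_i a i).+1 * r = (\sum_i a i * r + r.-1).+1.
      by rewrite -big_distrl /= mulSn; lia.
    apply/dsA.2; exists (upd [ffun i => a i * r] j (a j * r + r.-1)).
      apply: upd_mem => [i|]; first by rewrite ffunE; exact: Aa.
      by apply/(blk (a j) r.-1 _).1; [lia | exact: Aa].
    rewrite (sum_upd (fun=> id)) [in RHS](bigD1 j) //= addnAC; congr (_ + _ + _).
    by apply: eq_bigr => i _; rewrite ffunE.
  have [a Aa ea] : exists2 a : vec m, forall i, A i (a i) & \sum_i a i = x * r.
    by apply/dsA.2; lia.
  (* Off [j] all summands are multiples of [r], and so is the total; hence the [j]-th one is too. *)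
  have ed i : a i = a i %/ r * r.
    have [->|ij] := eqVneq i j; last exact: blki _ _ ij (Aa i).
    apply/esym/eqP; rewrite -dvdn_eq.
    have : r %| \sum_i a i by rewrite ea dvdn_mull.
    rewrite (bigD1 j) //= dvdn_addl // dvdn_sum // => i' ij'.
    by rewrite dvdn_eq -(blki _ _ ij' (Aa i')).
  exists [ffun i => a i %/ r] => [i|]; rewrite ?ffunE; first by rewrite /= -ed.
  apply/eqP; rewrite -(eqn_pmul2r r0) -ea big_distrl /=; apply/eqP.
  by apply: eq_bigr => i _; rewrite ffunE -ed.
have [j' [p [/andP[p0 pN] lt_p sum_p]]] : exists j p, [/\ 0 < p < N %/ r,
    forall i x, i != j -> A' i x -> x < p &
    forall a : vec m, (forall i, A' i (a i) /\ a i < p) -> \sum_i a i < p].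
  apply: IH dsA' _; first by rewrite ltn_Pdiv.
  by rewrite leq_divRL // mul2n.
exists j', (p * r); split.
- rewrite muln_gt0 p0 r0 /=.
  by apply: leq_trans (leq_trunc_div N r); rewrite ltn_pmul2r.
- by move=> i x ij Ax; rewrite -ltn_divLR //; apply: lt_p _ _ ij _; exact: Adiv.
move=> a Aa.
have h : \sum_i [ffun i => a i %/ r] i < p.
  apply: sum_p => i; have [Ai ai] := Aa i; rewrite ffunE ltn_divLR //.
  by split=> //; exact: Adiv.
(* Only the [j]-th summand can leave a remainder, so the total stays inside one block, which lies
   below [p * r]. *)
suff -> : \sum_i a i = (\sum_i [ffun i => a i %/ r] i) * r + a j %% r.
  have := ltn_pmod (a j) r0; nia.
rewrite big_distrl /= (bigD1 j) //= [in RHS](bigD1 j) //= addnAC ffunE -divn_eq.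
congr (_ + _); apply: eq_bigr => i ij; rewrite ffunE.
by have [Ai _] := Aa i; exact: blki _ _ ij Ai.
Qed.

(** * Counting index vectors and restricting the range *)

Lemma in_range_enum (m : nat) (n : vec m) :
  exists s : seq (vec m),
    [/\ uniq s, forall k, k \in s <-> in_range n k & size s = \prod_i n i].
Proof.
(* The type [vec m] is infinite, so the range is enumerated by finite functions into a common
   ordinal ['I_K], shifted by one because indices start at 1. *)
pose K := \max_i n i.
have nK i : n i <= K by exact: leq_bigmax.
pose F (i : 'I_m) := [pred y : 'I_K | y < n i].
pose g (phi : {ffun 'I_m -> 'I_K}) : vec m := [ffun i => (val (phi i)).+1].
exists [seq g phi | phi <- enum (family F)]; split.
- rewrite map_inj_uniq ?enum_uniq // => phi psi /ffunP e.
  by apply/ffunP => i; have := e i; rewrite !ffunE => -[/val_inj].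
- move=> k; split=> [/mapP[phi]|[k0 kn]].
    rewrite mem_enum => /familyP h ->; split=> i; rewrite ffunE //.
    exact: h.
  have kK i : (k i).-1 < K by rewrite prednK ?k0 // (leq_trans (kn i)).
  apply/mapP; exists [ffun i => Ordinal (kK i)].
    rewrite mem_enum; apply/familyP => i; rewrite ffunE inE /=.
    by rewrite prednK ?k0 // kn.
  by apply/ffunP => i; rewrite !ffunE /= prednK.
rewrite size_map -cardE card_family foldrE big_map big_enum /=.
apply: eq_bigr => i _; rewrite -sum1_card.
rewrite (big_ord_narrow_cond (P := xpredT) (nK i) (F := fun=> 1)).
by rewrite sum1_card card_ord.
Qed.

(** A surjection between finite sets is injective exactly when their sizes agree. One direction
    yields injectivity of a cuboid, the other the size of the subcuboid cut off at [p]. *)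
Lemma in_range_inj (m : nat) (n : vec m) (M : cuboid m) (N : nat) :
  (forall v, (exists2 k, in_range n k & M k = v) <-> v < N) ->
  (forall k k', in_range n k -> in_range n k' -> M k = M k' -> k = k')
  <-> \prod_i n i = N.
Proof.
move=> cov; have [s [us mem_s <-]] := in_range_enum n.
have eq_s : iota 0 N =i [seq M k | k <- s].
  move=> v; rewrite mem_iota /=; apply/idP/mapP => [/cov[k kn <-]|[k ks ->]].
    by exists k => //; apply/mem_s.
  by apply/cov; exists k => //; apply/mem_s.
have := uniq_size_uniq (iota_uniq 0 N) eq_s; rewrite size_iota size_map => e.
split=> [injM|sN].
  apply/eqP; rewrite -e map_inj_in_uniq // => k k' /mem_s ks /mem_s ks'.
  exact: injM.
have uMs : uniq [seq M k | k <- s] by rewrite e sN.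
move=> k k' /mem_s ks /mem_s ks' eM.
rewrite -(nth_index k ks) -(nth_index k ks'); congr nth.
move: (eM); rewrite -{1}(nth_index k ks) -{1}(nth_index k ks').
rewrite -!(nth_map k (M k)) ?index_mem // => /eqP.
by rewrite nth_uniq ?size_map ?index_mem // => /eqP.
Qed.

(** Applied to each axis, it turns the bound [p] on values into a dimension [c], positive because
    [g 1 < p]. *)
Lemma threshold (g : nat -> nat) (n p : nat) :
  0 < n -> (forall y z, 0 < y -> y < z -> z <= n -> g y < g z) -> g 1 < p ->
  exists c, 0 < c <= n /\ forall y, 0 < y <= n -> (g y < p) = (y <= c).
Proof.
move=> n0 mono g1.
pose P y := (0 < y <= n) && (g y < p).
have exP : exists y, P y by exists 1; rewrite /P n0 g1.
have ubP y : P y -> y <= n by case/andP => /andP[].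
case: (ex_maxnP exP ubP) => c /andP[cn gc] maxc; exists c; split=> // y yn.
apply/idP/idP => [gy|]; first by apply: maxc; rewrite /P yn.
rewrite leq_eqVlt => /predU1P[-> //|yc]; apply: ltn_trans gc.
by apply: mono => //; lia.
Qed.

Lemma in_range_upd (m : nat) (n k : vec m) i a :
  in_range n k -> 0 < a <= n i -> in_range n (upd k i a).
Proof.
by move=> [k0 kn] /andP[a0 an]; split=> x; rewrite ffunE; case: eqP => // ->.
Qed.

Lemma in_range_ones (m : nat) (n : vec m) : posvec n -> in_range n (ones m).
Proof. by move=> n0; split=> i; rewrite ffunE //; exact: n0. Qed.

Lemma in_range_vle (m : nat) (n n' k : vec m) :
  vle n' n -> in_range n' k -> in_range n k.
Proof. by move=> n'n [k0 kn]; split=> // i; apply: leq_trans (n'n i). Qed.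

(** Property (V) and monotonicity are inherited by a smaller range; only the set of entries has to
    be checked. *)
Lemma principal_reversible_sub (m : nat) (n n' : vec m) (M : cuboid m) :
  principal_reversible n M -> vle n' n -> posvec n' ->
  (forall v, (exists2 k, in_range n' k & M k = v) <-> v < \prod_j n' j) ->
  principal_reversible n' M.
Proof.
move=> [_ VM _ monoM] n'n n'0 cov; split=> //.
  move=> i j k a b ij /(in_range_vle n'n) kn; have := n'n i; have := n'n j.
  by move=> nj ni ha hb; apply: VM => //; lia.
move=> k j l /(in_range_vle n'n) kn hl; apply: monoM => //.
by have := n'n j; lia.
Qed.

(** * Principal reversible cuboids as direct sums of their axes *)

Section Cuboid.

Variables (m : nat) (n : vec m) (M : cuboid m).
Hypothesis prM : principal_reversible n M.

Let N := \prod_j n j.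
Let f (i : 'I_m) (x : nat) : nat := M (upd (ones m) i x).

Lemma cuboid_pos : posvec n. Proof. by case: prM. Qed.

Lemma cuboid_cover v : (exists2 k, in_range n k & M k = v) <-> v < N.
Proof. by case: prM. Qed.

Lemma cuboid_inj k k' : in_range n k -> in_range n k' -> M k = M k' -> k = k'.
Proof. exact: (in_range_inj cuboid_cover).2. Qed.

Lemma cuboid_mono k i a :
  in_range n k -> k i < a <= n i -> M k < M (upd k i a).
Proof.
move=> kn ka; have [_ _ _ mono] := prM.
have -> : upd k i a = shift k (a - k i) i.
  by apply/ffunP => x; rewrite !ffunE; case: eqP => [->|_] /=; lia.
by apply: mono => //; lia.
Qed.

(** At the position of the entry 0, resetting a coordinate above 1 to 1 would produce an entry below
    0. *)
Lemma cuboid_ones : M (ones m) = 0.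
Proof.
have [k kn Mk] : exists2 k, in_range n k & M k = 0.
  by apply/cuboid_cover; apply: prodn_gt0; exact: cuboid_pos.
suff -> : ones m = k by [].
apply/ffunP => i; rewrite ffunE; apply/eqP; rewrite eqn_leq kn.1 leqNgt.
apply/negP => ki.
have kn1 : in_range n (upd k i 1) by apply: in_range_upd => //; exact: cuboid_pos.
have := cuboid_mono (i := i) (a := k i) kn1.
rewrite ffunE eqxx ki kn.2 => /(_ isT).
have -> : upd (upd k i 1) i (k i) = k.
  by apply/ffunP => x; rewrite !ffunE; case: eqP => [->|].
by rewrite Mk.
Qed.

Lemma property_V_neq i j k a b : i != j -> in_range n k ->
  0 < a <= n i -> 0 < b <= n j ->
  M k + M (upd (upd k i a) j b) = M (upd k j b) + M (upd k i a).
Proof.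
move=> ij kn ha hb; have [_ VM _ _] := prM.
case: (ltngtP i j) => [lij|lji|/val_inj e]; first exact: VM.
  rewrite addnC [RHS]addnC -(VM j i k b a) // addnC; congr (_ + M _).
  apply/ffunP => x; rewrite !ffunE; case: eqP => [->|//].
  by rewrite eq_sym (negPf ij).
by rewrite e eqxx in ij.
Qed.

Lemma axis1 i : f i 1 = 0.
Proof.
rewrite /f -[RHS]cuboid_ones; congr M.
by apply/ffunP => x; rewrite !ffunE; case: eqP.
Qed.

(** Induction on the coordinate sum: if two coordinates differ from 1, (V) with both reset to 1
    expresses [M k] by three smaller vectors. Otherwise [k] lies on an axis. *)
Lemma cuboid_sum k : in_range n k -> M k = \sum_i f i (k i).
Proof.
have [s] := ubnP (\sum_i k i); elim: s k => // s IH k ks kn.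
have n0 := cuboid_pos.
case: (pickP (fun i => k i != 1)) => [i ki|k1]; last first.
  have -> : k = ones m.
    by apply/ffunP => i; have := k1 i; rewrite ffunE => /negbFE/eqP.
  by rewrite cuboid_ones big1 // => i _; rewrite ffunE axis1.
case: (pickP (fun j => (j != i) && (k j != 1))) => [j /andP[ji kj]|k1]; last first.
  have e x : x != i -> k x = 1 by move=> xi; have := k1 x; rewrite xi => /negbFE/eqP.
  rewrite (bigD1 i) //= big1 ?addn0 => [|x xi]; last by rewrite e // axis1.
  congr M; apply/ffunP => x; rewrite !ffunE.
  by case: eqP => [->//|/eqP xi]; exact: e.
have sm (k' : vec m) x : in_range n k' -> k' x != 1 -> \sum_i upd k' x 1 i < \sum_i k' i.
  move=> [k'0 _] k'x; rewrite (sum_upd (fun=> id)) [ltnRHS](bigD1 x) //= ltn_add2r.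
  by have := k'0 x; lia.
have ski := sm k i kn ki; have skj := sm k j kn kj.
have kni : in_range n (upd k i 1) by apply: in_range_upd => //; exact: n0.
have knj : in_range n (upd k j 1) by apply: in_range_upd => //; exact: n0.
have knij : in_range n (upd (upd k i 1) j 1) by apply: in_range_upd => //; exact: n0.
have skij := sm (upd k i 1) j kni.
rewrite ffunE (negPf ji) in skij; have {}skij := skij kj.
have := @property_V_neq i j k 1 1; rewrite eq_sym => /(_ ji kn (n0 i) (n0 j)).
rewrite (IH _ _ kni) ?(IH _ _ knj) ?(IH _ _ knij); try lia.
have := sum_updD f k i 1; have := sum_updD f k j 1.
have := sum_updD f (upd k i 1) j 1; rewrite !axis1 [upd k i 1 j]ffunE (negPf ji).
lia.
Qed.

Lemma in_range_axis i a : 0 < a <= n i -> in_range n (upd (ones m) i a).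
Proof. by move=> ?; apply: in_range_upd => //; apply/in_range_ones/cuboid_pos. Qed.

Lemma axis_mono i y z : 0 < y -> y < z -> z <= n i -> f i y < f i z.
Proof.
move=> y0 yz zn; have yn : in_range n (upd (ones m) i y).
  by apply: in_range_axis; lia.
have -> : f i z = M (upd (upd (ones m) i y) i z).
  by congr M; apply/ffunP => x; rewrite !ffunE; case: eqP.
by apply: cuboid_mono => //; rewrite ffunE eqxx yz.
Qed.

Lemma cuboid_direct_sum :
  direct_sum (fun i => [pred x | x \in [seq f i y | y <- iota 1 (n i)]]) N.
Proof.
(* Choices of one element from each axis set are index vectors, so uniqueness of sums is injectivity
   of [M]. *)
have lift (a : vec m) : (forall i, a i \in [seq f i y | y <- iota 1 (n i)]) ->
    exists k, [/\ in_range n k, forall i, a i = f i (k i) & \sum_i a i = M k].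
  move=> Aa; have /fin_all_exists[k hk] i : exists y, 0 < y <= n i /\ a i = f i y.
    have /mapP[y] := Aa i; rewrite mem_iota => hy ->; exists y; split=> //; lia.
  have kn : in_range n (finfun k).
    by split=> i; rewrite ffunE; have [/andP[]] := hk i.
  exists (finfun k); split=> //; first by move=> i; rewrite ffunE; case: (hk i).
  rewrite cuboid_sum //; apply: eq_bigr => i _.
  by rewrite ffunE; case: (hk i).
split=> [a b /lift[k [kn ak ->]] /lift[k' [k'n bk' ->]] /(cuboid_inj kn k'n) e|x].
  by apply/ffunP => i; rewrite ak bk' e.
split=> [[a /lift[k [kn _ ->]] <-]|/cuboid_cover[k kn <-]].
  by apply/cuboid_cover; exists k.
exists [ffun i => f i (k i)] => [i|].
  rewrite ffunE; apply/mapP; exists (k i) => //.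
  by rewrite mem_iota; have := kn.1 i; have := kn.2 i; lia.
by rewrite cuboid_sum //; apply: eq_bigr => i _; rewrite ffunE.
Qed.

(** Each axis is cut where its values reach the [p] of the topmost block. The last clause makes the
    result comparable with every other principal reversible subcuboid. *)
Lemma top_subcuboid : 1 < N ->
  exists j n', [/\ proper_pr_subcuboid n M n',
    forall i, i != j -> n' i = n i &
    forall k, in_range n k ->
      M k < \prod_i n' i <-> in_range n' k].
Proof.
move=> N1.
have [j [p [/andP[p0 pN] lt_p sum_p]]] := direct_sum_top cuboid_direct_sum N1.
have n0 := cuboid_pos.
have /fin_all_exists[c hc] i : exists c,
    0 < c <= n i /\ forall y, 0 < y <= n i -> (f i y < p) = (y <= c).
  apply: threshold; [exact: n0 | exact: axis_mono | by rewrite axis1].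
pose n' : vec m := finfun c.
have n'n : vle n' n by move=> i; rewrite ffunE; have [/andP[]] := hc i.
have n'0 : posvec n' by move=> i; rewrite ffunE; have [/andP[]] := hc i.
have n'P i y : 0 < y <= n i -> (f i y < p) = (y <= n' i).
  by rewrite ffunE; have [_] := hc i; apply.
have Mp k : in_range n k -> M k < p <-> in_range n' k.
  move=> kn; have ki i : 0 < k i <= n i by rewrite kn.1 kn.2.
  split=> [Mk|k'n].
    split=> [|i]; first exact: kn.1.
    rewrite -n'P //; apply: leq_ltn_trans Mk.
    by rewrite cuboid_sum // (bigD1 i) //= leq_addr.
  have -> : M k = \sum_i [ffun i => f i (k i)] i.
    by rewrite cuboid_sum //; apply: eq_bigr => i _; rewrite ffunE.
  apply: sum_p => i; rewrite ffunE n'P // k'n.2; split=> //=.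
  apply/mapP; exists (k i) => //.
  by rewrite mem_iota; have := ki i; lia.
have cov v : (exists2 k, in_range n' k & M k = v) <-> v < p.
  split=> [[k k'n <-]|vp]; first by apply/Mp => //; exact: in_range_vle n'n k'n.
  have [k kn Mk] := (cuboid_cover v).2 (ltn_trans vp pN).
  by exists k => //; apply/Mp => //; rewrite Mk.
have prod_n' : \prod_i n' i = p.
  apply/(in_range_inj cov) => k k' /(in_range_vle n'n) kn /(in_range_vle n'n).
  exact: cuboid_inj.
exists j, n'; split; last by rewrite prod_n'.
- split=> //; first by move=> e; move: pN; rewrite -prod_n' e ltnn.
  by apply: principal_reversible_sub prM n'n n'0 _; rewrite prod_n'.
(* Off [j] even the last axis value [f i (n i)] is below [p], so nothing is cut. *)
move=> i ij; apply/eqP; rewrite eqn_leq n'n -n'P ?n0 ?leqnn //=.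
apply: lt_p ij _; apply/mapP; exists (n i) => //.
by rewrite mem_iota; have := n0 i; lia.
Qed.

End Cuboid.

(** * Comparison of a maximal subcuboid with the topmost block *)

Theorem theorem6 (m : nat) (n : vec m) (M : cuboid m) (nt : vec m) :
  2 <= m ->
  posvec n ->
  n <> ones m ->
  principal_reversible n M ->
  maximal_proper_pr_subcuboid n M nt ->
  exists j : 'I_m, forall i : 'I_m, i <> j -> nt i = n i.
Proof.
move=> _ n0 n1 prM [[ntn _ prt] maxt].
have N1 : 1 < \prod_i n i.
  have [i ni] : exists i, n i != 1.
    apply/existsP; apply: contra_notT n1; rewrite negb_exists => /forallP h.
    by apply/ffunP => i; rewrite ffunE; have := h i; rewrite negbK => /eqP.
  have nn : in_range n (upd (ones m) i (n i)).
    by apply: (in_range_axis prM); rewrite n0 leqnn.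
  apply: leq_ltn_trans (_ : M (upd (ones m) i (n i)) < _).
    have := cuboid_mono prM (in_range_ones n0) (i := i) (a := n i).
    by rewrite (cuboid_ones prM) ffunE; apply; have := n0 i; lia.
  by apply/(cuboid_cover prM); exists (upd (ones m) i (n i)).
have [j [n' [prn' n'j n'P]]] := top_subcuboid prM N1.
exists j => i /eqP ij; have [Lp|pL] := leqP (\prod_i nt i) (\prod_i n' i).
  (* The end of each axis of [nt] carries an entry below [\prod_i nt i], hence below [\prod_i n' i],
     and so lies in the range of [n']. *)
  have le_nt : vle nt n'.
    move=> x; have nt0 := cuboid_pos prt.
    have rt : in_range nt (upd (ones m) x (nt x)).
      by apply: (in_range_axis prt); rewrite nt0 leqnn.
    have : in_range n' (upd (ones m) x (nt x)).
      apply/n'P; first exact: in_range_vle ntn rt.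
      apply: leq_trans Lp; apply/(cuboid_cover prt).
      by exists (upd (ones m) x (nt x)).
    by move=> [_ /(_ x)]; rewrite ffunE eqxx.
  have -> : nt = n'.
    by apply/eqP; apply: contra_notT maxt => /eqP ne; exists n'.
  exact: n'j.
have rn : in_range n (upd (ones m) i (n i)).
  by apply: (in_range_axis prM); rewrite n0 leqnn.
have rn' : in_range n' (upd (ones m) i (n i)).
  have [_ _ pr'] := prn'.
  by rewrite -(n'j i ij); apply: (in_range_axis pr'); rewrite (cuboid_pos pr') leqnn.
(* The entry at the end of the [i]-th axis of [M] is small enough to occur in the range of [nt]; by
   injectivity it occurs at that same position, so [n i <= nt i]. *)
have /(cuboid_cover prt)[k kt Mk] := ltn_trans ((n'P _ rn).2 rn') pL.
have e := cuboid_inj prM (in_range_vle ntn kt) rn Mk.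
apply/eqP; rewrite eqn_leq ntn /=.
by have := kt.2 i; rewrite e ffunE eqxx.
Qed.
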